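(* Let $E$ be a nontrivial (i.e. $E\neq\{0\}$) Archimedean real vector lattice, let $n\in\mathbb{N}$, let $h\in\mathcal{H}(\mathbb{R}^n)$, and assume that $E$ is $h$-complete. Then the following are equivalent. (i) $h\colon\mathbb{R}^n\to\mathbb{R}$ is symmetric. (ii) The function $h\colon E^n\to E$ defined via the Archimedean functional calculus is symmetric. (iii) The function $h\colon E^n\to E$ defined via the Archimedean functional calculus is total orderization invariant.
   Context: $\mathbb{N}$ is the set of strictly positive integers and $[n]:=\{1,\dots,n\}$. Functional calculus: $\mathcal{H}(\mathbb{R}^n)$ is the space of continuous functions $h\colon\mathbb{R}^n\to\mathbb{R}$ that are positively homogeneous, i.e. $h(\lambda x)=\lambda h(x)$ for all real $\lambda\geq 0$ and $x\in\mathbb{R}^n$. For $f_1,\dots,f_n,g\in E$ and $h\in\mathcal{H}(\mathbb{R}^n)$, one writes $h(f_1,\dots,f_n)=g$ when $h(\omega(f_1),\dots,\omega(f_n))=\omega(g)$ holds for every nonzero real-valued vector lattice homomorphism $\omega$ defined on the vector sublattice of $E$ generated by $\{f_1,\dots,f_n,g\}$ (such a $g$ is unique if it exists). $E$ is called $h$-complete if for all $f_1,\dots,f_n\in E$ there exists $g\in E$ with $h(f_1,\dots,f_n)=g$; this yields a function $h\colon E^n\to E$. A function of $n$ variables is symmetric if its value is unchanged under every permutation of its arguments. For $f_1,\dots,f_n\in E$ and $k\in[n]$, $$\mathcal{M}_k(f_1,\dots,f_n)=\bigvee_{\substack{i_1,\dots,i_{n+1-k}\in[n]\\ i_1<i_2<\cdots<i_{n+1-k}}}\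 \bigwedge_{j=1}^{n+1-k}f_{i_j}.$$ A map $T\colon E^n\to A$ into a nonempty set $A$ is total orderization invariant if $T(f_1,\dots,f_n)=T\bigl(\mathcal{M}_1(f_1,\dots,f_n),\dots,\mathcal{M}_n(f_1,\dots,f_n)\bigr)$ for all $f_1,\dots,f_n\in E$. *)

(* Defs.v *)
From HB Require Import structures.
From mathcomp Require Import all_boot all_order all_algebra all_fingroup.
From mathcomp Require Import all_classical all_reals all_analysis.

Set Implicit Arguments.
Unset Strict Implicit.
Unset Printing Implicit Defensive.

Import Order.TTheory GRing.Theory Num.Theory.
Import numFieldNormedType.Exports.

Local Open Scope classical_set_scope.
Local Open Scope ring_scope.

HB.mixin Record Lmodule_POrder_isVectorLattice (R : numDomainType) E
    of GRing.Lmodule R E & Order.POrder ring_display E := {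
  vjoin : E -> E -> E;
  vmeet : E -> E -> E;
  vjoin_le : forall x y z : E, (vjoin x y <= z) = (x <= z) && (y <= z);
  le_vmeet : forall x y z : E, (z <= vmeet x y) = (z <= x) && (z <= y);
  vlat_leD2r : forall x y z : E, x <= y -> x + z <= y + z;
  vlat_scale_ge0 : forall (a : R) (x : E), 0 <= a -> 0 <= x -> 0 <= a *: x
}.

(* The library has no structure joining its lattices with additive groups
   below the totally ordered number domains, so suprema and infima of pairs are
   required directly on top of a partially ordered module. *)
#[short(type="vectorLatticeType")]
HB.structure Definition VectorLattice (R : numDomainType) :=
  { E of GRing.Lmodule R E & Order.POrder ring_display E
       & Lmodule_POrder_isVectorLattice R E }.

Definition vlat_archimedean (R : numDomainType) (E : vectorLatticeType R) : Prop :=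
  forall x y : E, 0 <= x -> (forall k : nat, x *+ k <= y) -> x = 0.

Record vector_sublattice (R : numDomainType) (E : vectorLatticeType R)
    (S : set E) : Prop := VectorSublattice {
  vsublat0 : S 0;
  vsublatD : forall x y, S x -> S y -> S (x + y);
  vsublatZ : forall (a : R) x, S x -> S (a *: x);
  vsublatU : forall x y, S x -> S y -> S (vjoin x y);
  vsublatI : forall x y, S x -> S y -> S (vmeet x y)
}.

Definition gen_vector_sublattice (R : numDomainType) (E : vectorLatticeType R)
    (G : set E) : set E :=
  smallest (@vector_sublattice R E) G.

(* A homomorphism defined on the sublattice S is encoded by a total function
   w : E -> R of which only the restriction to S is used. *)
Record vlat_hom_on (R : realType) (E : vectorLatticeType R)
    (S : set E) (w : E -> R) : Prop := VlatHomOn {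
  vlat_homD : forall x y, S x -> S y -> w (x + y) = w x + w y;
  vlat_homZ : forall (a : R) x, S x -> w (a *: x) = a * w x;
  vlat_homU : forall x y, S x -> S y -> w (vjoin x y) = Num.max (w x) (w y);
  vlat_homI : forall x y, S x -> S y -> w (vmeet x y) = Num.min (w x) (w y)
}.

Record pos_homogeneous_continuous (R : realType) (n : nat)
    (h : 'rV[R]_n -> R) : Prop := PosHomogeneousContinuous {
  phc_continuous : continuous h;
  phc_homogeneous : forall (a : R) (x : 'rV[R]_n), 0 <= a -> h (a *: x) = a * h x
}.

(* h(f_1, ..., f_n) = g *)
Definition fcalc_rel (R : realType) (E : vectorLatticeType R) (n : nat)
    (h : 'rV[R]_n -> R) (f : 'rV[E]_n) (g : E) : Prop :=
  let S := gen_vector_sublattice (g |` range (f 0)) in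
  forall w : E -> R, vlat_hom_on S w -> (exists2 x, S x & w x <> 0) ->
    h (map_mx w f) = w g.

Definition fcalc_complete (R : realType) (E : vectorLatticeType R) (n : nat)
    (h : 'rV[R]_n -> R) : Prop :=
  forall f : 'rV[E]_n, exists g : E, fcalc_rel h f g.

(* In an Archimedean E the element g is unique, so the choice is immaterial. *)
Definition fcalc (R : realType) (E : vectorLatticeType R) (n : nat)
    (h : 'rV[R]_n -> R) (hE : fcalc_complete E h) (f : 'rV[E]_n) : E :=
  projT1 (cid (hE f)).

Definition symmetric_fun (T A : Type) (n : nat) (F : 'rV[T]_n -> A) : Prop :=
  forall (s : 'S_n) (f : 'rV[T]_n), F (\row_i f 0 (s i)) = F f.

(* E has no top or bottom; these are meant for nonempty s,
   and 0 is an arbitrary value for the empty sequence. *)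
Definition seq_join (R : numDomainType) (E : vectorLatticeType R) (s : seq E) : E :=
  if s is x :: s' then foldl vjoin x s' else 0.

Definition seq_meet (R : numDomainType) (E : vectorLatticeType R) (s : seq E) : E :=
  if s is x :: s' then foldl vmeet x s' else 0.

(* Indices start at 0: the k-th orderization, k : 'I_n, is M_{k+1}, so the
   increasing index tuples have length n + 1 - (k + 1) = n - k >= 1. *)
Definition orderization (R : numDomainType) (E : vectorLatticeType R) (n : nat)
    (k : 'I_n) (f : 'rV[E]_n) : E :=
  seq_join [seq seq_meet [seq f 0 i | i <- tval t]
           | t : (n - k).-tuple 'I_n in
               [pred t : (n - k).-tuple 'I_n | sorted ltn (map val t)]].

Definition total_orderization_invariant (R : numDomainType)
    (E : vectorLatticeType R) (A : Type) (n : nat) (T : 'rV[E]_n -> A) : Prop :=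
  forall f : 'rV[E]_n, T f = T (\row_k orderization k f).

(* Main.v *)
(* Real-valued lattice homomorphisms separate the points of every principal
   ideal [{x | |x| <= c e}] of an Archimedean vector lattice.  Hence an identity
   in E can be checked after applying such a homomorphism w, where the functional
   calculus turns into evaluation of h at (w f_1, ..., w f_n), and M_k(f) becomes
   the k-th smallest of the reals w f_i.  Conversely, evaluating at
   f_i = x_i e with e > 0 recovers h from its action on E.

   Separation needs no quotient by a maximal ideal: by Zorn there is a maximal
   convex cone P that is closed under upper bounds and meets and avoids -e; it
   contains x or -x for every x, and w x is the cut of the reals t with x - t e in P. *)
Require Import Defs.
From mathcomp Require Import all_boot all_order all_algebra.
From mathcomp Require Import all_classical all_reals all_analysis.
From mathcomp Require Import all_fingroup lra zify.

Set Implicit Arguments.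
Unset Strict Implicit.
Unset Printing Implicit Defensive.

Import Order.TTheory GRing.Theory Num.Theory.

Local Open Scope classical_set_scope.
Local Open Scope ring_scope.

(** * Order arithmetic in vector lattices, and principal ideals *)

Section VectorLatticeTheory.
Variables (R : realType) (E : vectorLatticeType R).
Implicit Types (a b c : R) (x y z : E).

Lemma vleD2r z x y : (x + z <= y + z) = (x <= y).
Proof.
apply/idP/idP => [|/vlat_leD2r -> //].
by move=> /(@vlat_leD2r _ E _ _ (- z)); rewrite !addrK.
Qed.

Lemma vleD2l z x y : (z + x <= z + y) = (x <= y).
Proof. by rewrite ![z + _]addrC vleD2r. Qed.

Lemma vleD x y z t : x <= y -> z <= t -> x + z <= y + t.
Proof. by move=> xy zt; apply: (@le_trans _ _ (y + z)); rewrite ?vleD2r ?vleD2l. Qed.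

Lemma vaddr_ge0 x y : 0 <= x -> 0 <= y -> 0 <= x + y.
Proof. by move=> x0 y0; rewrite -[0]addr0 vleD. Qed.

Lemma vleDl x y : 0 <= y -> x <= x + y.
Proof. by move=> y0; rewrite -[X in X <= _]addr0 vleD2l. Qed.

Lemma vsubr_ge0 x y : (0 <= y - x) = (x <= y).
Proof. by rewrite -[LHS](vleD2r x) add0r subrK. Qed.

Lemma vleN2 x y : (- x <= - y) = (y <= x).
Proof. by rewrite -[LHS]vsubr_ge0 opprK addrC vsubr_ge0. Qed.

Lemma vleBlDr x y z : (x - y <= z) = (x <= z + y).
Proof. by rewrite -[LHS](vleD2r y) subrK. Qed.

Lemma vleBrDr x y z : (x <= y - z) = (x + z <= y).
Proof. by rewrite -[RHS](vleD2r (- z)) addrK. Qed.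

Lemma vscale_le a x y : 0 <= a -> x <= y -> a *: x <= a *: y.
Proof.
by move=> a0; rewrite -vsubr_ge0 => /(vlat_scale_ge0 _ _ a0); rewrite scalerBr vsubr_ge0.
Qed.

Lemma vscale_ler a b x : a <= b -> 0 <= x -> a *: x <= b *: x.
Proof.
by move=> ab x0; rewrite -[_ <= _]vsubr_ge0 -scalerBl; apply: vlat_scale_ge0;
  rewrite ?subr_ge0.
Qed.

Lemma vscale_leN a b x : a <= b -> x <= 0 -> b *: x <= a *: x.
Proof.
move=> ab x0; rewrite -vleN2 -!scalerN; apply: vscale_ler => //.
by rewrite -oppr0 vleN2.
Qed.

Lemma vmeet_lel x y : vmeet x y <= x.
Proof. by have := lexx (vmeet x y); rewrite le_vmeet => /andP[]. Qed.

Lemma vmeet_ler x y : vmeet x y <= y.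
Proof. by have := lexx (vmeet x y); rewrite le_vmeet => /andP[]. Qed.

Lemma vjoin_gel x y : x <= vjoin x y.
Proof. by have := lexx (vjoin x y); rewrite vjoin_le => /andP[]. Qed.

Lemma vjoin_ger x y : y <= vjoin x y.
Proof. by have := lexx (vjoin x y); rewrite vjoin_le => /andP[]. Qed.

Lemma vmeetC x y : vmeet x y = vmeet y x.
Proof. by apply/le_anti; rewrite !le_vmeet !vmeet_lel !vmeet_ler. Qed.

Lemma vmeetDr x y z : vmeet x y + z = vmeet (x + z) (y + z).
Proof.
apply/le_anti; rewrite le_vmeet !vleD2r vmeet_lel vmeet_ler /=.
by rewrite -vleBlDr le_vmeet !vleBlDr vmeet_lel vmeet_ler.
Qed.

Lemma vmeetZ a x y : 0 <= a -> a *: vmeet x y = vmeet (a *: x) (a *: y).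
Proof.
rewrite le_eqVlt => /predU1P[<-|a0].
  by rewrite !scale0r; apply/le_anti; rewrite vmeet_lel le_vmeet lexx.
apply/le_anti; rewrite le_vmeet !vscale_le ?vmeet_lel ?vmeet_ler ?(ltW a0) //=.
have a1 : 0 <= a^-1 by rewrite invr_ge0 ltW.
have aK z : a *: (a^-1 *: z) = z by rewrite scalerA mulfV ?scale1r ?gt_eqF.
have Ka z : a^-1 *: (a *: z) = z by rewrite scalerA mulVf ?scale1r ?gt_eqF.
rewrite -[X in X <= _]aK; apply: vscale_le; first exact: ltW.
rewrite le_vmeet -[X in _ <= X]Ka -[X in _ && (_ <= X)]Ka.
by rewrite !vscale_le ?vmeet_lel ?vmeet_ler.
Qed.

Lemma vjoinE x y : vjoin x y = - vmeet (- x) (- y).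
Proof.
apply/le_anti; rewrite vjoin_le -[x <= _]vleN2 -[y <= _]vleN2 opprK.
rewrite vmeet_lel vmeet_ler -[X in _ && X]vleN2 opprK le_vmeet !vleN2.
by rewrite vjoin_gel vjoin_ger.
Qed.

(* With [x^+ = x - (x meet 0)] and [x^- = - (x meet 0)]: [x^+ meet x^- = 0]. *)
Lemma vmeet_pos_neg x : vmeet (- vmeet x 0) (x - vmeet x 0) = 0.
Proof. by rewrite -[- _ in X in vmeet X]add0r -vmeetDr (vmeetC 0) addrN. Qed.

Definition order_ideal (e : E) : set E :=
  [set x | exists2 c : R, 0 <= c & - (c *: e) <= x /\ x <= c *: e].

Lemma order_idealP e x : 0 <= e -> (exists c d, - (c *: e) <= x /\ x <= d *: e) ->
  order_ideal e x.
Proof.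
move=> e0 [c [d [cx xd]]]; pose m := Num.max 0 (Num.max c d).
exists m; first by rewrite le_max lexx.
split; first (apply: le_trans cx; rewrite vleN2); last apply: (le_trans xd);
  by apply: vscale_ler => //; rewrite !le_max lexx ?orbT.
Qed.

Lemma order_ideal_id e : 0 <= e -> order_ideal e e.
Proof.
move=> e0; exists 1 => //; rewrite scale1r; split=> //; apply: (le_trans _ e0).
by rewrite -oppr0 vleN2.
Qed.

Lemma order_ideal_le e e' x : e <= e' -> order_ideal e x -> order_ideal e' x.
Proof.
move=> ee' [c c0 [cx xc]]; exists c => //; split.
  by apply: le_trans cx; rewrite vleN2 vscale_le.
by apply: le_trans xc _; rewrite vscale_le.
Qed.

Lemma order_ideal_vector_sublattice e : 0 <= e -> vector_sublattice (order_ideal e).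
Proof.
move=> e0; have IN x : order_ideal e x -> order_ideal e (- x).
  by case=> c c0 [cx xc]; exists c => //; rewrite -[- x <= _]vleN2 opprK vleN2.
have II x y : order_ideal e x -> order_ideal e y -> order_ideal e (vmeet x y).
  move=> [c c0 [cx xc]] [d d0 [dy yd]]; apply: order_idealP => //.
  exists (Num.max c d), c; split; last exact: le_trans (vmeet_lel _ _) xc.
  rewrite le_vmeet; apply/andP; split; [apply: le_trans cx|apply: le_trans dy];
    by rewrite vleN2 vscale_ler // le_max lexx ?orbT.
have Zp a x : 0 <= a -> order_ideal e x -> order_ideal e (a *: x).
  move=> a0 [c c0 [cx xc]]; exists (a * c); first exact: mulr_ge0.
  by rewrite -scalerA -scalerN !vscale_le.
split=> //.
- by exists 0; rewrite // scale0r oppr0.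
- move=> x y [c c0 [cx xc]] [d d0 [dy yd]]; exists (c + d); first exact: addr_ge0.
  by rewrite scalerDl opprD !vleD.
- move=> a x xe; have [|a0] := leP 0 a; first by move/Zp; apply.
  by rewrite -[a]opprK scaleNr; apply/IN/Zp; rewrite // oppr_ge0 ltW.
- by move=> x y xe ye; rewrite vjoinE; apply/IN/II; apply/IN.
Qed.

Lemma vpos_neg_eq0 x : vjoin x 0 = 0 -> vjoin (- x) 0 = 0 -> x = 0.
Proof.
move=> x0 nx0; apply/le_anti; rewrite -{1}x0 vjoin_gel /=.
by rewrite -vleN2 oppr0 -nx0 vjoin_gel.
Qed.

(** Adding [|x| = x^+ + x^-] for each entry produces the bound [e]; all elements of an identity can
    thus be tested inside one principal ideal. *)
Lemma seq_order_ideal (s : seq E) :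
  exists2 e : E, 0 <= e & forall x, x \in s -> order_ideal e x.
Proof.
elim: s => [|x s [e e0 IHs]]; first by exists 0.
have p0 (y : E) : 0 <= vjoin y 0 by exact: vjoin_ger.
have ee' : e <= e + (vjoin x 0 + vjoin (- x) 0) by rewrite vleDl ?vaddr_ge0.
have e'0 := le_trans e0 ee'.
exists (e + (vjoin x 0 + vjoin (- x) 0)) => // y; rewrite in_cons => /predU1P[->|ys].
  exists 1 => //; rewrite scale1r -[- _ <= _]vleN2 opprK; split.
    apply: le_trans (vjoin_gel (- x) 0) _.
    by rewrite addrA [X in _ <= X]addrC vleDl ?vaddr_ge0.
  apply: le_trans (vjoin_gel x 0) _.
  by rewrite addrCA vleDl ?vaddr_ge0.
exact: order_ideal_le (IHs _ ys).
Qed.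

End VectorLatticeTheory.

(** * Maximal cones closed under meets *)

Section Separation.
Variables (R : realType) (E : vectorLatticeType R).
Implicit Types (a b c r t : R) (x y z e : E) (P : set E).

(** Modelled on [{x | 0 <= w x}] for a lattice homomorphism [w], which turns meets into minima. *)
Record meet_cone P : Prop := MeetCone {
  mcone_le : forall x y, P x -> x <= y -> P y;
  mconeD : forall x y, P x -> P y -> P (x + y);
  mconeZ : forall a x, 0 <= a -> P x -> P (a *: x);
  mconeI : forall x y, P x -> P y -> P (vmeet x y)
}.

(* It suffices to adjoin the negative part [x meet 0], since
   [min_i (p_i + a_i x) >= min_i p_i + (max_i a_i) (x meet 0)]. *)
Definition mcone_adjoin P x : set E :=
  [set y | exists p, P p /\ exists2 a, 0 <= a & p + a *: vmeet x 0 <= y].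

Lemma mcone_adjoinP P x : meet_cone P -> meet_cone (mcone_adjoin P x).
Proof.
move=> PP; have x0 : vmeet x 0 <= 0 := vmeet_ler _ _; split.
- by move=> y z [p [Pp [a a0 py]]] yz; exists p; split=> //; exists a => //;
    apply: le_trans yz.
- move=> y z [p [Pp [a a0 py]]] [q [Pq [b b0 qz]]]; exists (p + q).
  split; first exact: mconeD; exists (a + b); first exact: addr_ge0.
  by rewrite scalerDl addrACA vleD.
- move=> c y c0 [p [Pp [a a0 py]]]; exists (c *: p); split; first exact: mconeZ.
  by exists (c * a); [exact: mulr_ge0|rewrite -scalerA -scalerDr vscale_le].
- move=> y z [p [Pp [a a0 py]]] [q [Pq [b b0 qz]]]; exists (vmeet p q).
  split; first exact: mconeI.
  (* As [vmeet x 0 <= 0], the larger coefficient gives the smaller multiple, below both. *)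
  exists (Num.max a b); first by rewrite le_max a0.
  rewrite le_vmeet; apply/andP; split; [apply: le_trans py|apply: le_trans qz];
    by apply: vleD; rewrite ?vmeet_lel ?vmeet_ler // vscale_leN // le_max lexx ?orbT.
Qed.

Lemma mcone_adjoin_sub P x : P `<=` mcone_adjoin P x.
Proof. by move=> p Pp; exists p; split=> //; exists 0 => //; rewrite scale0r addr0. Qed.

Lemma mcone_adjoin_id P x : P 0 -> mcone_adjoin P x x.
Proof.
by move=> P0; exists 0; split=> //; exists 1; rewrite // scale1r add0r vmeet_lel.
Qed.

Lemma mcone_ge0 P x : meet_cone P -> P !=set0 -> 0 <= x -> P x.
Proof.
move=> PP [y Py]; apply: (mcone_le PP).
by rewrite -(scale0r y); apply: mconeZ.
Qed.

(** Maximality forces totality: if adjoining [y] and adjoining [- y] both produced [- e], the meet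
    of the two witnesses would already lie below [- e], since [y^+] and [y^-] are disjoint. *)
Lemma maximal_mcone e x : ~ mcone_adjoin [set y | 0 <= y] x (- e) ->
  exists P, [/\ meet_cone P, ~ P (- e), P x &
    forall y, P y \/ P (- y)].
Proof.
move=> Qe; set Q := mcone_adjoin _ _ in Qe.
have QP : meet_cone Q.
  apply: mcone_adjoinP; split => /=.
  - by move=> y z; exact: le_trans.
  - exact: vaddr_ge0.
  - by move=> a y; exact: vlat_scale_ge0.
  - by move=> y z y0 z0; rewrite le_vmeet y0.
have Qx : Q x by apply: mcone_adjoin_id; exact: lexx.
(* Membership of [x] is imposed only on nonempty [P], because the union of the empty chain must
   satisfy [F]. *)
pose F P := [/\ meet_cone P, ~ P (- e) & P !=set0 -> P x].
have [G GF Gtot|P [[PP Pe Px] Pmax]] := @Zorn_bigcup E F.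
  split.
  - have cmp X Y y z : G X -> G Y -> X y -> Y z -> exists2 Z, G Z & Z y /\ Z z.
      move=> GX GY Xy Yz; have [XY|YX] := Gtot _ _ GX GY.
        by exists Y => //; split=> //; exact: XY.
      by exists X => //; split=> //; exact: YX.
    split.
    + by move=> y z [X GX Xy] yz; exists X => //; have [XP _ _] := GF _ GX; exact: mcone_le yz.
    + move=> y z [X GX Xy] [Y GY Yz]; have [Z GZ [Zy Zz]] := cmp _ _ _ _ GX GY Xy Yz.
      by exists Z => //; have [ZP _ _] := GF _ GZ; exact: mconeD.
    + by move=> a y a0 [X GX Xy]; exists X => //; have [XP _ _] := GF _ GX; exact: mconeZ.
    + move=> y z [X GX Xy] [Y GY Yz]; have [Z GZ [Zy Zz]] := cmp _ _ _ _ GX GY Xy Yz.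
      by exists Z => //; have [ZP _ _] := GF _ GZ; exact: mconeI.
  - by move=> [X GX]; have [_ + _] := GF _ GX.
  - by move=> [y [X GX Xy]]; exists X => //; have [_ _] := GF _ GX; apply; exists y.
have Pn0 : P !=set0.
  apply: contrapT => Pn0; apply: (Pmax Q) => //.
  by split=> [y Py|/(_ _ Qx) Px']; exfalso; apply: Pn0; [exists y|exists x].
have P0 : P 0 by exact: mcone_ge0.
exists P; split=> //; first exact: Px.
have adj y : ~ P y -> mcone_adjoin P y (- e).
  move=> Py; apply: contrapT => ne; apply: (Pmax (mcone_adjoin P y)).
    by split; [exact: mcone_adjoin_sub|move/(_ _ (mcone_adjoin_id y P0))].
  split=> //; first exact: mcone_adjoinP.
  by move=> _; apply/mcone_adjoin_sub/Px.
move=> y; apply: contrapT => /not_orP[/adj[p [Pp [a a0 pe]]] /adj[q [Pq [b b0 qe]]]].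
apply: Pe; apply: (mcone_le PP (mconeI PP Pp Pq)).
pose m := Num.max a b; have m0 : 0 <= m by rewrite le_max a0.
have yN : - vmeet (- y) 0 = y - vmeet y 0.
  by have := vmeetDr 0 y (- y); rewrite add0r subrr => <-; rewrite opprB (vmeetC 0).
(* Each witness is bounded through one part of [y]: [p <= m y^- - e] and [q <= m y^+ - e]. *)
have bd s c z : c <= m -> s + c *: vmeet z 0 <= - e -> s <= m *: (- vmeet z 0) - e.
  move=> cm; rewrite -vleBrDr => /le_trans; apply.
  by rewrite scalerN [X in _ <= X]addrC vleD2l vleN2 vscale_leN ?vmeet_ler.
rewrite -[- e]add0r -(scaler0 E m) -(vmeet_pos_neg y) -yN vmeetZ // vmeetDr le_vmeet.
apply/andP; split.
  by apply: le_trans (vmeet_lel _ _) _; apply: bd pe; rewrite le_max lexx.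
by apply: le_trans (vmeet_ler _ _) _; apply: bd qe; rewrite le_max lexx orbT.
Qed.
End Separation.

(** * The homomorphism cut out by a total cone, and separation of points *)

Section ConeValue.
Variables (R : realType) (E : vectorLatticeType R) (P : set E) (e : E).
Hypotheses (PP : meet_cone P) (Pe : ~ P (- e)) (e0 : 0 <= e).
Hypothesis Ptot : forall y, P y \/ P (- y).
Implicit Types (a b c r s t : R) (x y z : E).

Lemma mcone_unit a : P (a *: e) -> 0 <= a.
Proof.
move=> Pa; rewrite leNgt; apply/negP => a0; apply: Pe.
have := @mconeZ _ _ _ PP (- a^-1) _ _ Pa; rewrite scalerA mulNr mulVf ?lt_eqF //.
by rewrite scaleN1r oppr_ge0 invr_le0; apply; exact: ltW.
Qed.

(** A Dedekind cut expressing [w x = r]. Nothing is asked at [t = r], which leaves slack to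
    distribute in the algebraic laws. *)
Definition cone_value x r :=
  forall t, (t < r -> P (x - t *: e)) /\ (r < t -> P (t *: e - x)).

Lemma cone_value_unique x r s : cone_value x r -> cone_value x s -> r = s.
Proof.
suff lt r' s' : cone_value x r' -> cone_value x s' -> ~ r' < s'.
  move=> xr xs; apply/le_anti; rewrite !leNgt.
  by apply/andP; split; apply/negP; apply: lt.
(* Two points strictly between [r'] and [s'], the smaller one used above [r'] and the larger below
   [s']: the two cone elements then add up to a negative multiple of [e]. *)
move=> xr xs rs; have [_ P1] := xr (r' + (s' - r') / 3).
have [P2 _] := xs (r' + (s' - r') / 2).
have := mconeD PP (P1 _) (P2 _); rewrite addrA subrK -scalerBl => H.
have : 0 <= r' + (s' - r') / 3 - (r' + (s' - r') / 2).
  by apply: mcone_unit; apply: H; lra.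
by lra.
Qed.

(** The supremum of the [t] with [x - t *: e] in [P] works: the bounds on [x] make this set nonempty
    and bounded above, and totality gives [t *: e - x] in [P] for every [t] outside it. *)
Lemma cone_value_ex x : order_ideal e x -> exists r, cone_value x r.
Proof.
move=> [c c0 [cx xc]]; pose A := [set t | P (x - t *: e)].
have Pge0 y : 0 <= y -> P y.
  move=> y0; apply: (mcone_ge0 PP) => //.
  by have [] := Ptot 0; [exists 0|exists (- 0)].
have A0 : A !=set0.
  by exists (- c); rewrite /A /= scaleNr opprK; apply: Pge0; rewrite -vleBlDr sub0r.
have ubA : ubound A c.
  move=> t At; rewrite -subr_ge0; apply: mcone_unit; rewrite scalerBl.
  by apply: (mcone_le PP At); rewrite vleD2r.
exists (sup A) => t; split=> tA.
  have [s As ts] := sup_gt A0 tA; apply: (mcone_le PP As).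
  by rewrite vleD2l vleN2 vscale_ler // ltW.
have [//|] := Ptot (t *: e - x); rewrite opprB => At.
by move: tA; rewrite ltNge => /negP[]; apply: ub_le_sup => //; exists c.
Qed.

Lemma cone_valueD x y r s :
  cone_value x r -> cone_value y s -> cone_value (x + y) (r + s).
Proof.
(* Half of the slack [r + s - t] goes to each summand. *)
move=> xr ys t; pose d := (r + s - t) / 2.
have -> : t = (r - d) + (s - d) by rewrite /d; lra.
have [P1 P2] := xr (r - d); have [Q1 Q2] := ys (s - d).
split=> lt; rewrite scalerDl.
  by rewrite opprD addrACA; apply: (mconeD PP); [apply: P1|apply: Q1]; lra.
by rewrite opprD addrACA; apply: (mconeD PP); [apply: P2|apply: Q2]; lra.
Qed.

Lemma cone_valueN x r : cone_value x r -> cone_value (- x) (- r).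
Proof.
move=> xr t; have [P1 P2] := xr (- t); split=> lt.
  by rewrite addrC -scaleNr; apply: P2; lra.
by rewrite opprK addrC -[t]opprK scaleNr; apply: P1; lra.
Qed.

Lemma cone_value_unit : cone_value e 1.
Proof.
have Pe1 : P e by have [//|/Pe] := Ptot e.
move=> t; split=> lt.
  by rewrite -[X in X - _]scale1r -scalerBl; apply: mconeZ => //; rewrite subr_ge0 ltW.
by rewrite -[X in _ - X]scale1r -scalerBl; apply: mconeZ => //; rewrite subr_ge0 ltW.
Qed.

Lemma cone_valueZ a x r : cone_value x r -> cone_value (a *: x) (a * r).
Proof.
suff Zp b : 0 < b -> cone_value x r -> cone_value (b *: x) (b * r).
  have [a0|a0|->] := ltrgtP a 0 => xr; last 2 first.
  - exact: Zp.
  - rewrite scale0r mul0r -(subrr e) -(subrr (1 : R)).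
    exact: cone_valueD cone_value_unit (cone_valueN cone_value_unit).
  rewrite -[a]opprK scaleNr mulNr; apply/cone_valueN/Zp => //.
  by rewrite oppr_gt0.
move=> b0 xr t; have [P1 P2] := xr (b^-1 * t).
have -> : t *: e = b *: ((b^-1 * t) *: e) by rewrite scalerA mulrA mulfV ?mul1r ?gt_eqF.
split=> lt; rewrite -scalerBr; apply: (mconeZ PP); rewrite ?ltW //.
  by apply: P1; rewrite mulrC ltr_pdivrMr // mulrC.
by apply: P2; rewrite mulrC ltr_pdivlMr // mulrC.
Qed.

Lemma cone_valueI x y r s :
  cone_value x r -> cone_value y s -> cone_value (vmeet x y) (Num.min r s).
Proof.
move=> xr ys t; have [P1 P2] := xr t; have [Q1 Q2] := ys t; split.
  rewrite lt_min => /andP[/P1 tr /Q1 ts].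
  by rewrite vmeetDr; exact: mconeI.
rewrite gt_min => /orP[/P2|/Q2] H; apply: (mcone_le PP H);
  by rewrite vleD2l vleN2 ?vmeet_lel ?vmeet_ler.
Qed.

Lemma cone_value_ge0 x r : P x -> cone_value x r -> 0 <= r.
Proof.
move=> Px xr; rewrite leNgt; apply/negP => r0; have [_ /(_ _)] := xr (r / 2).
move=> /(_ ltac:(lra)) /(mconeD PP) /(_ Px); rewrite subrK => /mcone_unit; lra.
Qed.

(** The default 0 applies where no cut exists, which does not happen on [order_ideal e]. *)
Definition cone_functional x : R := xget 0 (cone_value x).

Lemma cone_functionalP x r : cone_value x r -> cone_functional x = r.
Proof. by move=> xr; apply: cone_value_unique (xr); apply: xgetPex; exists r. Qed.

Lemma cone_functional_hom : vlat_hom_on (order_ideal e) cone_functional.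
Proof.
have val x : order_ideal e x -> cone_value x (cone_functional x).
  by move=> /cone_value_ex; exact: xgetPex.
split.
- by move=> x y /val xr /val yr; apply/cone_functionalP/cone_valueD.
- by move=> a x /val xr; apply/cone_functionalP/cone_valueZ.
- move=> x y /val xr /val yr; rewrite vjoinE -[Num.max _ _]opprK oppr_max.
  by apply/cone_functionalP/cone_valueN/cone_valueI; apply: cone_valueN.
- by move=> x y /val xr /val yr; apply/cone_functionalP/cone_valueI.
Qed.

End ConeValue.

(* A homomorphism separating [u] from [0] exists because some multiple [k u^+]
   is not below [e], so that [k u^+ - e] can be forced to be nonnegative. *)
Lemma vlat_separation (R : realType) (E : vectorLatticeType R) (e u : E) :
  vlat_archimedean E -> 0 <= e -> order_ideal e u -> u <> 0 ->
  exists2 w : E -> R, vlat_hom_on (order_ideal e) w & w u <> 0.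
Proof.
move=> archE e0 eu u0; have eS := order_ideal_vector_sublattice e0.
have e_0 : order_ideal e 0 := vsublat0 eS.
(* One of [u^+] and [u^-] is nonzero, so up to sign it suffices to treat a nonzero positive part. *)
suff pos v : order_ideal e v -> vjoin v 0 <> 0 ->
    exists2 w : E -> R, vlat_hom_on (order_ideal e) w & w v <> 0.
  have [v0|] := pselect (vjoin u 0 = 0); last exact: pos.
  have [nv0|/pos[]] := pselect (vjoin (- u) 0 = 0).
    by case: u0; exact: vpos_neg_eq0.
    by rewrite -scaleN1r; exact: vsublatZ.
  move=> w wH; rewrite -scaleN1r (vlat_homZ wH) // mulN1r => wu; exists w => // wu0.
  by apply: wu; rewrite wu0 oppr0.
move=> ev v0; set p := vjoin v 0 in v0.
have p0 : 0 <= p := vjoin_ger _ _.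
have ep : order_ideal e p by exact: vsublatU.
have [k kp] : exists k, ~ (p *+ k <= e).
  by apply/not_existsP => H; apply: v0; apply: (archE p e) => // k; have /contrapT := H k.
pose x := p *+ k - e.
(* Otherwise [e <= a x^-]; as [x^+ <= k p <= k c e], this bounds [x^+] by a multiple of the disjoint
   [x^-], hence [x^+ = 0] and [k p <= e]. *)
have Qe : ~ mcone_adjoin [set y | 0 <= y] x (- e).
  move=> [q [/= q0 [a a0 qe]]]; apply: kp; rewrite -vsubr_ge0 -vleN2 oppr0 opprB -/x.
  have {q0 qe} eA : e <= a *: (- vmeet x 0).
    by rewrite scalerN -vleN2 opprK; apply: le_trans qe; rewrite addrC vleDl.
  have nA : 0 <= - vmeet x 0 by rewrite -[0 <= _]vleN2 opprK oppr0 vmeet_ler.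
  have [c c0 [_ pc]] := ep.
  have dC : x - vmeet x 0 <= (k%:R * c * a) *: (- vmeet x 0).
    have kp0 : 0 <= p *+ k by rewrite -scaler_nat vlat_scale_ge0 ?ler0n.
    apply: (@le_trans _ _ (p *+ k)).
      rewrite vleBlDr {1}/x vleD2l le_vmeet -[- e <= 0]vleN2 opprK oppr0 e0.
      by rewrite /x addrC vleDl.
    rewrite -scaler_nat -!mulrA -!scalerA; apply: vscale_le; rewrite ?ler0n //.
    by apply: le_trans pc _; exact: vscale_le.
  (* With this [M], both [M x^-] and [M x^+] dominate [x^+], and their meet is 0. *)
  pose M := Num.max 1 (k%:R * c * a).
  suff : x - vmeet x 0 <= 0.
    by rewrite vleBlDr add0r => /le_trans; apply; exact: vmeet_ler.
  have M0 : 0 <= M by rewrite le_max ler01.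
  rewrite -[X in _ <= X](scaler0 E M) -[X in _ *: X](vmeet_pos_neg x) vmeetZ //.
  rewrite le_vmeet; apply/andP; split.
    by apply: le_trans dC _; apply: vscale_ler; rewrite // le_max lexx orbT.
  rewrite -[X in X <= _]scale1r vscale_ler ?le_max ?lexx //.
  by rewrite vsubr_ge0 vmeet_lel.
have [P [PP Pe Px Ptot]] := maximal_mcone Qe.
have wH := cone_functional_hom PP Pe e0 Ptot.
set w := cone_functional P e in wH.
have we : w e = 1 by exact/cone_functionalP/cone_value_unit.
(* If [w v = 0] then [w p = 0], so [w x = - w e = -1], although [x] lies in [P]. *)
exists w => // wv.
have wp : w p = 0.
  by rewrite (vlat_homU wH) // wv -(scale0r e) (vlat_homZ wH) ?mul0r ?maxxx //;
    exact: order_ideal_id.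
have kpS : order_ideal e (p *+ k) by rewrite -scaler_nat; exact: vsublatZ.
have ee : order_ideal e (- e).
  by rewrite -scaleN1r; apply: vsublatZ => //; exact: order_ideal_id.
have [r xr] := cone_value_ex PP Pe e0 Ptot (vsublatD eS kpS ee).
have := cone_value_ge0 PP Pe Px xr; rewrite -(cone_functionalP PP Pe xr) -/w.
rewrite (vlat_homD wH) // -scaler_nat (vlat_homZ wH) // wp mulr0 add0r -scaleN1r.
by rewrite (vlat_homZ wH) ?we; [lra|exact: order_ideal_id].
Qed.

(** A homomorphism separating [x - y] from 0 would contradict the hypothesis. The list [l] names
    further elements, in practice the arguments [f_i], that must lie in the domain of [w]. *)
Lemma vlat_hom_ext (R : realType) (E : vectorLatticeType R) (l : seq E) (x y : E) :
  vlat_archimedean E ->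
  (forall (e : E) (w : E -> R), 0 <= e ->
     {in x :: y :: l, forall z, order_ideal e z} ->
     vlat_hom_on (order_ideal e) w -> w x = w y) ->
  x = y.
Proof.
move=> archE H; have [e e0 le] := seq_order_ideal (x :: y :: l).
have [ex ey] : order_ideal e x /\ order_ideal e y.
  by split; apply: le; rewrite !inE eqxx ?orbT.
have eS := order_ideal_vector_sublattice e0.
have eN : order_ideal e (- y) by rewrite -scaleN1r; exact: vsublatZ.
apply: subr0_eq; apply: contrapT => xy.
have [w wH] := vlat_separation archE e0 (vsublatD eS ex eN) xy.
rewrite (vlat_homD wH) // -scaleN1r (vlat_homZ wH) // mulN1r.
by rewrite (H e w) // subrr.
Qed.

(** * Homomorphisms on finite meets and joins, and order statistics *)

Section HomSeq.
Variables (R : realType) (E : vectorLatticeType R) (S : set E) (w : E -> R).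
Hypotheses (SS : vector_sublattice S) (wH : vlat_hom_on S w).

(** Values are described by the reals [t] below them, which turns meets and joins into [all] and
    [has] and suits counting. Nonemptiness rules out the default 0. *)
Lemma vlat_hom_seq_meet (s : seq E) : s != [::] -> {in s, forall x, S x} ->
  S (seq_meet s) /\ forall t, (t <= w (seq_meet s)) = all (fun x => t <= w x) s.
Proof.
case: s => // x s _; elim: s x => [|y s IHs] x Ss /=.
  by split=> [|t]; [apply: Ss; rewrite inE|rewrite andbT].
have Sx : S x by apply: Ss; rewrite !inE eqxx.
have Sy : S y by apply: Ss; rewrite !inE eqxx orbT.
have [|SM tM] := IHs (vmeet x y).
  move=> z; rewrite inE => /predU1P[->|zs]; first exact: vsublatI.
  by apply: Ss; rewrite !inE zs !orbT.
by split=> // t; rewrite tM /= (vlat_homI wH) // le_min andbA.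
Qed.

Lemma vlat_hom_seq_join (s : seq E) : s != [::] -> {in s, forall x, S x} ->
  S (seq_join s) /\ forall t, (t <= w (seq_join s)) = has (fun x => t <= w x) s.
Proof.
case: s => // x s _; elim: s x => [|y s IHs] x Ss /=.
  by split=> [|t]; [apply: Ss; rewrite inE|rewrite orbF].
have Sx : S x by apply: Ss; rewrite !inE eqxx.
have Sy : S y by apply: Ss; rewrite !inE eqxx orbT.
have [|SM tM] := IHs (vjoin x y).
  move=> z; rewrite inE => /predU1P[->|zs]; first exact: vsublatU.
  by apply: Ss; rewrite !inE zs !orbT.
by split=> // t; rewrite tM /= (vlat_homU wH) // le_max orbA.
Qed.

End HomSeq.

(** Strict increase makes the [m] entries distinct; conversely [enum A] is already increasing and
    can be truncated. This converts the index tuples in [M_k] into counting. *)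
Lemma sorted_tuple_exists (n m : nat) (A : pred 'I_n) :
  [exists t : m.-tuple 'I_n, sorted ltn (map val t) && all A t] = (m <= #|A|)%N.
Proof.
apply/existsP/idP => [[t /andP[/(sorted_uniq ltn_trans ltnn)]]|mA].
  rewrite map_inj_uniq; last exact: val_inj.
  move=> /card_uniqP tU /allP tA; rewrite -(size_tuple t) -tU.
  by apply: subset_leq_card; apply/fintype.subsetP => i /tA.
have st : size (take m (enum A)) == m by rewrite size_takel // -cardE.
exists (Tuple st) => /=; apply/andP; split; last first.
  by apply/allP => i /mem_take; rewrite mem_enum.
have sub : subseq (map val (take m (enum A))) (iota 0 n).
  rewrite -val_enum_ord; apply: map_subseq; apply: subseq_trans (take_subseq _ _) _.
  by rewrite enumT; exact: filter_subseq.
exact: (subseq_sorted ltn_trans sub (iota_ltn_sorted 0 n)).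
Qed.

Definition order_stat (R : realType) (n : nat) (a : 'rV[R]_n) : n.-tuple R :=
  [tuple of sort <=%R [tuple a 0 i | i < n]].

(** In the increasing arrangement the entries below [t] come first, so the one at 0-based position
    [k] is at least [t] exactly when at most [k] entries lie below [t]. *)
Lemma order_stat_ge (R : realType) (n : nat) (a : 'rV[R]_n) (k : 'I_n) (t : R) :
  (t <= tnth (order_stat a) k) = (n - k <= #|[pred i | (t <= a 0 i)%R]|)%N.
Proof.
have -> : #|[pred i | (t <= a 0 i)]| = count (>= t) (order_stat a).
  rewrite [RHS](seq.permP (permEl (perm_sort _ _)) (>= t)) /= count_map.
  by rewrite cardE /enum_mem size_filter -enumT filter_predT.
have ks : (k < size (order_stat a))%N by rewrite size_tuple.
have srt : sorted <=%R (order_stat a) by exact: (sort_sorted (@le_total _ R)).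
have cN : (count (>= t) (order_stat a) + count (< t) (order_stat a))%N = n.
  rewrite -[RHS](size_tuple (order_stat a)) -(count_predC (>= t)); congr addn.
  by apply: eq_count => r /=; rewrite ltNge.
rewrite (tnth_nth 0); have [ck|ck] := leqP (count (< t) (order_stat a)) k.
  rewrite nth_count_ge ?ck ?ks //; apply/esym; lia.
by rewrite leNgt nth_count_lt //; apply/esym/negbTE; rewrite -ltnNge; lia.
Qed.

(** Both reals have the same lower bounds: [r] is one exactly when at least [n - k] of the [w f_i]
    are [>= r], an increasing tuple of such indices selecting a meet of the join. *)
Lemma vlat_hom_orderization (R : realType) (E : vectorLatticeType R) (S : set E)
    (w : E -> R) (n : nat) (f : 'rV[E]_n) (k : 'I_n) :
  vector_sublattice S -> vlat_hom_on S w -> (forall i, S (f 0 i)) ->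
  S (orderization k f) /\ w (orderization k f) = tnth (order_stat (map_mx w f)) k.
Proof.
move=> SS wH Sf; have nk : (0 < n - k)%N by rewrite subn_gt0.
pose m (t : (n - k).-tuple 'I_n) := seq_meet [seq f 0 i | i <- tval t].
have mt (t : (n - k).-tuple 'I_n) :
    S (m t) /\ forall r, (r <= w (m t)) = all (fun i => r <= w (f 0 i)) t.
  have [||SM rM] := vlat_hom_seq_meet SS wH (s := [seq f 0 i | i <- tval t]).
  - by rewrite -size_eq0 size_map size_tuple -lt0n.
  - by move=> _ /mapP[i _ ->].
  by split=> // r; rewrite rM all_map.
pose A := [pred t : (n - k).-tuple 'I_n | sorted ltn (map val t)].
have [||SO rO] := vlat_hom_seq_join SS wH (s := [seq m t | t in A]).
- have /existsP[t /andP[tA _]] :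
      [exists t : (n - k).-tuple 'I_n, sorted ltn (map val t) && all predT t].
    by rewrite sorted_tuple_exists card_ord leq_subr.
  by rewrite -size_eq0 size_map -cardE -lt0n; apply/card_gt0P; exists t.
- by move=> _ /mapP[t _ ->]; have [] := mt t.
split=> //.
have rE r : (r <= w (orderization k f)) = (r <= tnth (order_stat (map_mx w f)) k).
  rewrite rO order_stat_ge has_map -sorted_tuple_exists; apply/hasP/existsP.
    move=> [t]; rewrite mem_enum => tA /=; rewrite (mt t).2 => rt.
    exists t; apply/andP; split; first exact: tA.
    by apply: sub_all rt => i /=; rewrite mxE.
  move=> [t /andP[tA rt]]; exists t; first by rewrite mem_enum.
  by rewrite /= (mt t).2; apply: sub_all rt => i /=; rewrite mxE.
by apply/le_anti; rewrite -rE lexx rE lexx.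
Qed.

(** * Transfer of symmetry between [h] on reals and on [E] *)

Section FunctionalCalculus.
Variables (R : realType) (E : vectorLatticeType R) (n : nat) (h : 'rV[R]_n -> R).
Hypotheses (hH : pos_homogeneous_continuous h) (hE : fcalc_complete E h).

(** The calculus only speaks of nonzero homomorphisms on the generated sublattice [S], which lies in
    the ideal. If [w] vanishes on [S], both sides are 0 by homogeneity. *)
Lemma vlat_hom_fcalc (e : E) (w : E -> R) (f : 'rV[E]_n) :
  0 <= e -> vlat_hom_on (order_ideal e) w -> (forall i, order_ideal e (f 0 i)) ->
  order_ideal e (fcalc hE f) -> h (map_mx w f) = w (fcalc hE f).
Proof.
move=> e0 wH ef eg; set g := fcalc hE f in eg *.
have eS := order_ideal_vector_sublattice e0.
set S := gen_vector_sublattice (g |` range (f 0)).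
have Sg : S g by apply: sub_gen_smallest; left.
have Sf i : S (f 0 i) by apply: sub_gen_smallest; right; exists i.
have Se : S `<=` order_ideal e by apply: smallest_sub => // x [->|[i _ <-]].
have [w0|nw0] := pselect (exists2 x, S x & w x <> 0).
  apply: (projT2 (cid (hE f))) => //; case: wH => wD wZ wU wI.
  by split=> *; [apply: wD|apply: wZ|apply: wU|apply: wI]; exact: Se.
have wS x : S x -> w x = 0 by move=> Sx; apply: contrapT => wx; apply: nw0; exists x.
have -> : map_mx w f = 0 *: 0.
  by rewrite scale0r; apply/rowP => i; rewrite !mxE wS.
by rewrite (phc_homogeneous hH) // mul0r wS.
Qed.

Hypothesis archE : vlat_archimedean E.

Lemma symmetric_fcalc : symmetric_fun h -> symmetric_fun (fcalc hE).
Proof.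
move=> hsym s f; apply: (@vlat_hom_ext _ _ (codom (f 0))) => // e w e0 le wH.
have ef i : order_ideal e (f 0 i) by apply: le; rewrite !inE codom_f !orbT.
have efs i : order_ideal e ((\row_j f 0 (s j)) 0 i) by rewrite mxE.
rewrite -!(vlat_hom_fcalc e0 wH) //;
  try by apply: le; rewrite !inE eqxx ?orbT.
by rewrite -[RHS](hsym s); congr h; apply/rowP => i; rewrite !mxE.
Qed.

Lemma symmetric_order_stat (a : 'rV[R]_n) : symmetric_fun h ->
  h (\row_k tnth (order_stat a) k) = h a.
Proof.
move=> hsym.
have /tuple_permP[s sE] : perm_eq (order_stat a) [tuple a 0 i | i < n].
  by rewrite perm_sort.
rewrite -[RHS](hsym s); congr h; apply/rowP => i; rewrite !mxE.
by rewrite (tnth_nth 0) sE -(tnth_nth 0) !tnth_mktuple.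
Qed.

Lemma symmetric_total_orderization_invariant :
  symmetric_fun h -> total_orderization_invariant (fcalc hE).
Proof.
move=> hsym f; apply: (@vlat_hom_ext _ _ (codom (f 0))) => // e w e0 le wH.
have ef i : order_ideal e (f 0 i) by apply: le; rewrite !inE codom_f !orbT.
have M k := vlat_hom_orderization k (order_ideal_vector_sublattice e0) wH ef.
have efM i : order_ideal e ((\row_j orderization j f) 0 i) by rewrite mxE; have [] := M i.
rewrite -!(vlat_hom_fcalc e0 wH) //;
  try by apply: le; rewrite !inE eqxx ?orbT.
rewrite -[LHS]symmetric_order_stat //; congr h; apply/rowP => i.
by rewrite !mxE; have [_ ->] := M i.
Qed.

(** The orderizations are themselves symmetric in [f]: [w] sends those of [f] and of its
    rearrangement to the same order statistics. *)
Lemma total_orderization_invariant_symmetric :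
  total_orderization_invariant (fcalc hE) -> symmetric_fun (fcalc hE).
Proof.
move=> inv s f; rewrite inv [RHS]inv; congr fcalc; apply/rowP => k; rewrite !mxE.
apply: (@vlat_hom_ext _ _ (codom (f 0))) => // e w e0 le wH.
have ef i : order_ideal e (f 0 i) by apply: le; rewrite !inE codom_f !orbT.
have eS := order_ideal_vector_sublattice e0.
have [_ ->] := vlat_hom_orderization k eS wH ef.
have [|_ ->] := @vlat_hom_orderization _ _ _ _ _ (\row_i f 0 (s i)) k eS wH.
  by move=> i; rewrite mxE.
congr tnth; apply: val_inj; apply/perm_sortP;
  [exact: le_total|exact: le_trans|exact: le_anti|].
apply/(@tuple_permP _ n _ [tuple (map_mx w f) 0 i | i < n]); exists s.
by congr val; apply: eq_from_tnth => i; rewrite !tnth_mktuple !mxE.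
Qed.

(** On multiples [a_i e] with [w e > 0], homogeneity gives [w (h (a_1 e, ..., a_n e)) = w e * h a],
    and the factor [w e] cancels. *)
Lemma fcalc_symmetric : (exists x : E, x <> 0) ->
  symmetric_fun (fcalc hE) -> symmetric_fun h.
Proof.
move=> [u u0] fsym s a.
have [e e0 en0] : exists2 e : E, 0 <= e & e <> 0.
  have [v0|] := pselect (vjoin u 0 = 0); last first.
    by exists (vjoin u 0) => //; exact: vjoin_ger.
  exists (vjoin (- u) 0); first exact: vjoin_ger.
  by move=> nv0; apply: u0; exact: vpos_neg_eq0.
pose f : 'rV[E]_n := \row_i (a 0 i *: e).
have [d d0 ld] := seq_order_ideal [:: e; fcalc hE f].
have ed : order_ideal d e by apply: ld; rewrite !inE eqxx.
have dS := order_ideal_vector_sublattice d0.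
have [w wH we] := vlat_separation archE d0 ed en0.
have we0 : 0 < w e.
  rewrite lt_def; apply/andP; split; first exact/eqP.
  have -> : e = vjoin e 0 by apply/le_anti; rewrite vjoin_gel vjoin_le lexx e0.
  have d0' : order_ideal d 0 by exact: vsublat0.
  by rewrite (vlat_homU wH) // -(scale0r e) (vlat_homZ wH) // mul0r le_max lexx orbT.
(* The hypothesis on [b] keeps the calculus value inside the ideal of [d], so that one [w] serves
   both [a] and its permutation. *)
have val (b : 'rV[R]_n) : fcalc hE (\row_i (b 0 i *: e)) = fcalc hE f ->
    w e * h b = w (fcalc hE f).
  move=> bf; rewrite -(phc_homogeneous hH) ?(ltW we0) // -bf -(vlat_hom_fcalc d0 wH).
  - by congr h; apply/rowP => i; rewrite !mxE (vlat_homZ wH) // mulrC.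
  - by move=> i; rewrite mxE; exact: vsublatZ.
  - by rewrite bf; apply: ld; rewrite !inE eqxx orbT.
apply: (mulfI (lt0r_neq0 we0)); rewrite (val a) // val //.
by rewrite -[RHS](fsym s); congr fcalc; apply/rowP => i; rewrite !mxE.
Qed.

End FunctionalCalculus.

Theorem theorem3p5 (R : realType) (E : vectorLatticeType R)
    (E_nontrivial : exists x : E, x <> 0) (E_archimedean : vlat_archimedean E)
    (n : nat) (n_gt0 : (0 < n)%N) (h : 'rV[R]_n -> R)
    (hH : pos_homogeneous_continuous h) (hE : fcalc_complete E h) :
  [<-> symmetric_fun h;
       symmetric_fun (fcalc hE);
       total_orderization_invariant (fcalc hE)].
Proof.
have sym_h := fcalc_symmetric hH E_archimedean E_nontrivial (hE := hE).
tfae.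
- exact: symmetric_fcalc.
(* From (ii) the route to (iii) passes through (i). *)
- by move=> /sym_h; exact: symmetric_total_orderization_invariant.
- by move=> /(total_orderization_invariant_symmetric E_archimedean); exact: sym_h.
Qed.
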